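(* Let $K$ be a field of characteristic $0$, $d\ge1$, and $m_1,\ldots,m_d\ge0$ integers with $m_1\ge1$. Set $M=m_1+\cdots+m_d+d-1$ and $\mathcal{I}=\{(i,s):1\le i\le d,\ 1\le s\le m_i+1\}\setminus\{(1,1)\}$. Let $N_1,\ldots,N_d$ be non-negative integers and, for $j=1,\ldots,d$, let $(r_0^{(j)},\ldots,r_{N_j}^{(j)})$ be integers with $m_j+1\ge r_0^{(j)}\ge\cdots\ge r_{N_j}^{(j)}\ge0$. Let $\alpha_1,\ldots,\alpha_d\in K$ with $\alpha_1=0$ and $\alpha_i-\alpha_j\notin\mathbb{Z}$ for distinct $i,j$. Define \[ A(t)=\prod_{j=1}^dB_j(t+\alpha_j),\qquad B_j(t)=\prod_{i=0}^{N_j}(t+i)^{r_i^{(j)}}. \] Then the $M\times M$ matrix $\big(\varphi_{\alpha_i,s}(t^\ell A(t))\big)_{(i,s)\in\mathcal{I},\,0\le\ell<M}$ is non-singular.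
   Context: $\binom{\alpha}{k}=\alpha(\alpha-1)\cdots(\alpha-k+1)/k!$. For $f=\sum_{k\ge0}f_kz^{-k-1}\in(1/z)K[[1/z]]$, $\varphi_f:K[t]\to K$ is the $K$-linear map $t^k\mapsto f_k$. Modified inverse Mellin transform: for $g\in K[[z]]$ write $g(e^z-1)=\sum_kb_kz^k/k!$ and set $\mathcal{M}^{-1}(g)=\sum_kb_k(-1/z)^{k+1}$. For $\alpha\in K$ and integer $s\ge1$: $R_{\alpha,s}=\mathcal{M}^{-1}\big((1+z)^\alpha\log^{s-1}(1+z)/z\big)$ if $s\ge2$, $R_{\alpha,1}=\mathcal{M}^{-1}\big(((1+z)^\alpha-1)/z\big)$, where $(1+z)^\alpha=\sum_k\binom\alpha kz^k$ and $\log(1+z)=\sum_{n\ge1}(-1)^{n-1}z^n/n$; and $\varphi_{\alpha,s}=\varphi_{R_{\alpha,s}}$. *)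

(* Defs.v *)
From HB Require Import structures.
From mathcomp Require Import all_boot all_order all_algebra.

Set Implicit Arguments.
Unset Strict Implicit.
Unset Printing Implicit Defensive.

Import GRing.Theory.
Local Open Scope ring_scope.

(* A sequence [nat -> K] encodes a formal series by its coefficients in two   *)
(* ways: as an element sum_n a_n z^n of K[[z]] (type [fps K]), and as an      *)
(* element sum_k f_k z^(-k-1) of (1/z)K[[1/z]] (type [fls K]).                *)
Definition fps (K : fieldType) := nat -> K.
Definition fls (K : fieldType) := nat -> K.

Section Series.
Variable K : fieldType.
Implicit Types (a b g h : fps K) (f : fls K) (alpha : K) (s n k : nat).

Definition fps_one : fps K := fun n => (n == 0)%:R.
Definition fps_sub a b : fps K := fun n => a n - b n.
Definition fps_mul a b : fps K := fun n => \sum_(i < n.+1) a i * b (n - i)%N.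
Definition fps_exp a k : fps K := iter k (fps_mul a) fps_one.

(* The composite g(h(z)). It is meant for h with zero constant term; then the *)
(* powers h^k with k > n do not contribute to the coefficient of z^n.         *)
Definition fps_comp g h : fps K :=
  fun n => \sum_(k < n.+1) g k * fps_exp h k n.

(* a(z)/z, meant for a with zero constant term. *)
Definition fps_divz a : fps K := fun n => a n.+1.

Definition expz : fps K := fun n => (n`!%:R)^-1.

Definition log1pz : fps K :=
  fun n => if n is n'.+1 then (-1) ^+ n' / n'.+1%:R else 0.

Definition gbinom alpha k : K := (\prod_(i < k) (alpha - i%:R)) / k`!%:R.

Definition pow1pz alpha : fps K := fun k => gbinom alpha k.

(* b_k = k! [z^k] g(e^z - 1), and (-1/z)^(k+1) = (-1)^(k+1) z^(-k-1). *)
Definition inv_mellin_coef g k : K :=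
  k`!%:R * fps_comp g (fps_sub expz fps_one) k.
Definition inv_mellin g : fls K :=
  fun k => inv_mellin_coef g k * (-1) ^+ k.+1.

(* Only s >= 1 is meaningful. *)
Definition Rser alpha s : fls K :=
  if (s <= 1)%N then inv_mellin (fps_divz (fps_sub (pow1pz alpha) fps_one))
  else inv_mellin (fps_divz (fps_mul (pow1pz alpha) (fps_exp log1pz (s - 1)))).

Definition phi f (p : {poly K}) : K := \sum_(k < size p) p`_k * f k.

Lemma phi_widen f n (p : {poly K}) :
  (size p <= n)%N -> phi f p = \sum_(k < n) p`_k * f k.
Proof.
move=> le_pn; rewrite /phi (big_ord_widen _ (fun k => p`_k * f k) le_pn).
rewrite big_mkcond; apply: eq_bigr => k _; case: ltnP => // le_pk.
by rewrite nth_default // mul0r.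
Qed.

Fact phi_is_linear f : linear_for *%R (phi f).
Proof.
move=> c p q; set n := maxn (size (c *: p + q)) (maxn (size p) (size q)).
rewrite !(@phi_widen f n) /n ?leq_max ?leqnn ?orbT //.
rewrite big_distrr -big_split /=; apply: eq_bigr => k _.
by rewrite coefD coefZ mulrDl mulrA.
Qed.

HB.instance Definition _ f :=
  GRing.isLinear.Build K {poly K} K *%R (phi f) (phi_is_linear f).

Lemma phiXn f k : phi f 'X^k = f k.
Proof.
rewrite /phi size_polyXn big_ord_recr /= coefXn eqxx mul1r big1 ?add0r // => i _.
by rewrite coefXn (ltn_eqF (ltn_ord i)) mul0r.
Qed.

End Series.

Section Indices.
Variables (d : nat) (hd : (0 < d)%N) (m : 'I_d -> nat).

(* The index 1 of {1, ..., d}. *)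
Definition idx1 : 'I_d := Ordinal hd.

Definition cI_size : nat := (\sum_(i < d) m i + d - 1)%N.

(* [i : 'I_d] is 0-based, [s] is 1-based. *)
Definition cI_seq : seq ('I_d * nat) :=
  [seq p <- [seq (i, s) | i <- enum 'I_d, s <- iota 1 (m i).+1]
     | p != (idx1, 1%N)].

Lemma mem_cI_seq i s :
  ((i, s) \in cI_seq)
  = (1 <= s <= (m i).+1)%N && ((i, s) != (idx1, 1%N)).
Proof.
rewrite mem_filter andbC; congr (_ && _).
apply/allpairsPdep/idP => [[i' [s' [_ + [-> ->]]]] | ltsm].
  by rewrite mem_iota add1n ltnS.
by exists i, s; rewrite mem_enum mem_iota add1n ltnS.
Qed.

Lemma cI_seq_uniq : uniq cI_seq.
Proof.
apply/filter_uniq/allpairs_uniq_dep => [|i _|[i s] [i' s'] _ _ /= [-> ->]] //.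
  exact: enum_uniq.
exact: iota_uniq.
Qed.

Lemma size_cI_seq : size cI_seq == cI_size.
Proof.
set t := [seq (i, s) | i <- enum 'I_d, s <- iota 1 (m i).+1].
have uniq_t : uniq t.
  apply: allpairs_uniq_dep => [|i _|[i s] [i' s'] _ _ /= [-> ->]] //.
    exact: enum_uniq.
  exact: iota_uniq.
have t11 : (idx1, 1%N) \in t.
  by apply/allpairsPdep; exists idx1, 1%N; rewrite mem_enum mem_iota.
have -> : cI_seq = rem (idx1, 1%N) t by rewrite rem_filter.
rewrite size_rem // -subn1 /cI_size /t size_allpairs_dep sumnE big_map.
rewrite big_enum /= (eq_bigr (fun i => m i + 1)%N) => [|i _].
  by rewrite big_split /= sum_nat_const card_ord muln1.
by rewrite size_iota addn1.
Qed.

Definition cI : cI_size.-tuple ('I_d * nat) := Tuple size_cI_seq.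

End Indices.

Section Matrix.
Variables (K : fieldType) (d : nat) (hd : (0 < d)%N) (m N : 'I_d -> nat).
Variables (r : forall j : 'I_d, 'I_(N j).+1 -> nat) (alpha : 'I_d -> K).

Definition Bpoly (j : 'I_d) : {poly K} :=
  \prod_(i < (N j).+1) ('X + (i%:R)%:P) ^+ r i.

Definition Apoly : {poly K} :=
  \prod_(j < d) (Bpoly j \Po ('X + (alpha j)%:P)).

Definition phi_matrix : 'M[K]_(cI_size m) :=
  \matrix_(k, l)
    let: (i, s) := tnth (cI hd m) k in
    phi (Rser (alpha i) s) ('X^l * Apoly).

End Matrix.

(* Main.v *)
(** Let Delta p = p(X + 1) - p. As (e^z - 1)^j is dual to Delta^j, reflecting
the variable gives phi_{M^-1(g)}(p(-X)) = - (g(Delta) p)(0), and in particular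
phi_{alpha,s}((Delta p)(-X)) = - p^(s-1)(alpha) whenever p(0) = 0, because
(1 + Delta)^alpha is translation by alpha and log(1 + Delta) is derivation.

A kernel vector of the matrix is a nonzero q of degree < M all of whose
phi_{alpha_i,s}(q A) vanish. Write (q A)(-X) = Delta p with p(0) = 0: then p has
a zero of order m_j + 1 at each alpha_j, and the factors of A force zeros of
order r_i^(j) at alpha_j + i + 1. These are more zeros than
deg p <= 1 + deg q + deg A allows. *)

Require Import Defs.
From HB Require Import structures.
From mathcomp Require Import all_boot all_order all_algebra.
From mathcomp Require Import ring zify.

Set Implicit Arguments.
Unset Strict Implicit.
Unset Printing Implicit Defensive.

Import GRing.Theory.
Local Open Scope ring_scope.

(** * Forward differences of polynomials *)

Section ForwardDifference.
Variable K : fieldType.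
Implicit Types (p q : {poly K}) (n j k : nat).

Definition fdiff p : {poly K} := (p \Po ('X + 1)) - p.

Fact fdiff_is_linear : linear fdiff.
Proof. by move=> c p q; rewrite /fdiff linearP scalerBr opprD addrACA. Qed.

HB.instance Definition _ :=
  GRing.isLinear.Build K {poly K} {poly K} *:%R fdiff fdiff_is_linear.

Fact iter_fdiff_is_linear j : linear (iter j fdiff).
Proof. by move=> c p q; elim: j => //= j ->; rewrite linearP. Qed.

HB.instance Definition _ j :=
  GRing.isLinear.Build K {poly K} {poly K} *:%R (iter j fdiff)
    (iter_fdiff_is_linear j).

(** [p] and p(X + 1) have the same leading coefficient, so the top terms cancel. *)
Lemma size_fdiff_leq p n : (size p <= n.+1)%N -> (size (fdiff p) <= n)%N.
Proof.
move=> le_pn; have sX : size ('X + 1 : {poly K}) = 2%N by rewrite size_XaddC.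
have scomp : size (p \Po ('X + 1)) = size p by rewrite size_comp_poly2.
apply/leq_sizeP => i; rewrite /fdiff coefB leq_eqVlt => /orP[/eqP <-|lt_ni].
  move: le_pn; rewrite leq_eqVlt => /orP[/eqP sp | lt_pn].
    have := lead_coef_comp p (q := 'X + 1).
    rewrite sX !lead_coefE scomp sp sX coefD coefX coef1 addr0 expr1n mulr1 /=.
    by move=> ->; rewrite // subrr.
  by rewrite !nth_default ?subrr ?scomp.
by rewrite !nth_default ?subrr ?scomp ?(leq_trans le_pn).
Qed.

Lemma iter_fdiff_eq0 p j : (size p <= j)%N -> iter j fdiff p = 0.
Proof.
elim: j p => [p|j IHj p le_pj].
  by rewrite leqn0 size_poly_eq0 => /eqP->.
by rewrite iterSr IHj // size_fdiff_leq.
Qed.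

Lemma size_iter_fdiff_leq p j n :
  (size p <= n)%N -> (size (iter j fdiff p) <= n)%N.
Proof.
by move=> le_pn; elim: j => //= j IHj; rewrite size_fdiff_leq // leqW.
Qed.

Lemma size_derivn_leq s p n : (size p <= n)%N -> (size p^`(s) <= n)%N.
Proof.
move=> le_pn; elim: s => // s IHs.
have [Dp|/lt_size_deriv/ltnW/leq_trans] := eqVneq p^`(s) 0; last first.
  by rewrite derivnS; apply.
by rewrite derivnS Dp deriv0 size_poly0.
Qed.

Lemma derivn_iter_fdiff s j p : (iter j fdiff p)^`(s) = iter j fdiff p^`(s).
Proof.
have deriv_fdiff q : (fdiff q)^`() = fdiff q^`().
  by rewrite /fdiff derivB deriv_comp derivD derivX derivC addr0 mulr1.
elim: s p => [|s IHs] p; first by [].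
rewrite !derivSn -IHs; congr (_^`(s)).
by elim: (j) => //= i <-; rewrite deriv_fdiff.
Qed.

(** Expanding (X + 1)^k gives a recursion in j that mirrors, up to factorials, multiplication of a
    series by e^z - 1. *)
Lemma iter_fdiff_Xn0 j k :
  (iter j.+1 fdiff 'X^k).[0]
  = \sum_(i < k.+1 | i != 0 :> nat)
      'C(k, i)%:R * (iter j fdiff 'X^(k - i)).[0].
Proof.
have -> : iter j.+1 fdiff 'X^k
    = iter j fdiff (\sum_(i < k.+1 | i != 0 :> nat) 'C(k, i)%:R *: 'X^(k - i)).
  rewrite iterSr; congr (iter j fdiff _).
  rewrite /fdiff comp_Xn_poly exprDn (bigD1 ord0) //= subn0 expr1n mulr1 bin0.
  rewrite mulr1n addrAC subrr add0r; apply: eq_big => // i _.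
  by rewrite expr1n mulr1 scaler_nat.
rewrite linear_sum horner_sum; apply: eq_bigr => i _.
by rewrite linearZ hornerZ.
Qed.

End ForwardDifference.

(** * Newton expansion and antidifferences in characteristic 0 *)

Section Newton.
Variable K : fieldType.
Hypothesis K0 : [pchar K] =i pred0.
Implicit Types (p q : {poly K}) (n j k : nat).

Lemma fact_neq0 n : n`!%:R != 0 :> K.
Proof. by rewrite (proj1 (pcharf0P K) K0) -lt0n fact_gt0. Qed.

Lemma natrS_neq0 n : n.+1%:R != 0 :> K.
Proof. by rewrite (proj1 (pcharf0P K) K0). Qed.

Lemma eqr_nat_pchar0 n k : (n%:R == k%:R :> K) = (n == k).
Proof.
wlog le_nk : n k / (n <= k)%N.
  move=> th; have [/th //|/ltnW/th] := leqP n k.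
  by rewrite eq_sym => ->; rewrite eq_sym.
rewrite eq_sym -subr_eq0 -natrB // (proj1 (pcharf0P K) K0) subn_eq0.
by rewrite eqn_leq le_nk.
Qed.

Lemma poly_nat_roots_eq0 p : (forall n, p.[n%:R] = 0) -> p = 0.
Proof.
move=> p0; apply/eqP; apply: contraT => nz_p.
pose s := [seq n%:R : K | n <- iota 0 (size p)].
suff : (size s < size p)%N by rewrite size_map size_iota ltnn.
apply: max_poly_roots => //; first by apply/allP=> _ /mapP[n _ ->]; apply/eqP.
rewrite map_inj_uniq ?iota_uniq // => n k /eqP.
by rewrite eqr_nat_pchar0 => /eqP.
Qed.

(** Such a [p] is constant on the natural numbers, which are infinitely many points of K. *)
Lemma fdiff_eq0 p : fdiff p = 0 -> p = (p.[0])%:P.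
Proof.
move/subr0_eq => Dp; apply/subr0_eq/poly_nat_roots_eq0 => n.
rewrite hornerD hornerN hornerC; apply/eqP; rewrite subr_eq0; apply/eqP.
elim: n => // n <-; rewrite -{2}Dp horner_comp hornerD hornerX hornerC.
by rewrite -natr1.
Qed.

(** Newton's basis: the binomial coefficient of X over n, as a polynomial in X. *)
Definition bpoly n : {poly K} := (n`!%:R)^-1 *: \prod_(i < n) ('X - i%:R%:P).

Lemma bpolyE n x : (bpoly n).[x] = gbinom x n.
Proof.
rewrite hornerZ horner_prod mulrC; congr (_ * _).
by apply: eq_bigr => i _; rewrite hornerXsubC.
Qed.

Lemma size_bpoly n : (size (bpoly n) <= n.+1)%N.
Proof.
apply: leq_trans (size_scale_leq _ _) _.
by rewrite size_prod_XsubC /index_enum -enumT size_enum_ord.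
Qed.

Lemma bpoly0 : bpoly 0 = 1.
Proof. by rewrite /bpoly big_ord0 invr1 scale1r. Qed.

Lemma bpolyS0 n : (bpoly n.+1).[0] = 0.
Proof. by rewrite bpolyE /gbinom big_ord_recl subrr !mul0r. Qed.

(** Pascal's rule. *)
Lemma fdiff_bpolyS n : fdiff (bpoly n.+1) = bpoly n.
Proof.
rewrite /fdiff /bpoly comp_polyZ rmorph_prod /= -scalerBr.
rewrite (eq_bigr (fun i : 'I_n.+1 => 'X + 1 - (i%:R)%:P)); last first.
  by move=> i _; rewrite comp_polyB comp_polyX comp_polyC.
rewrite big_ord_recl [X in _ - X]big_ord_recr /= subr0.
rewrite (eq_bigr (fun i : 'I_n => 'X - (i%:R)%:P)); last first.
  move=> i _; rewrite /bump /= add1n -[i.+1%:R]natr1 polyCD opprD.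
  by rewrite addrACA subrr addr0 addrC.
(* The shifted product is (X + 1) R and the original one R (X - n), so their difference is (n + 1)
   R. *)
set R := \prod_(i < n) _; rewrite -[X in X - _]mulrC -mulrBr opprB.
rewrite addrACA [X in X + _]addrC addrACA subrr addr0 addrC.
have -> : 1 + n%:R%:P = n.+1%:R%:P :> {poly K} by rewrite -natr1 polyCD addrC.
rewrite mulrC mul_polyC scalerA factS natrM invfM.
by congr (_ *: _); rewrite mulrAC mulVf ?mul1r ?natrS_neq0.
Qed.

(** Coefficientwise form of the fact that (1 + z)^x has x-derivative log(1 + z) at x = 0. *)
Lemma deriv_bpoly0 n : (bpoly n)^`().[0] = log1pz K n.
Proof.
case: n => [|n]; first by rewrite bpoly0 derivC horner0.
rewrite /bpoly derivZ hornerZ big_ord_recl subr0 derivM derivX mul1r.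
rewrite hornerD hornerM hornerX mul0r addr0 horner_prod /=.
have -> : \prod_(i < n) ('X - (bump 0 i)%:R%:P).[0] = (-1) ^+ n * n`!%:R :> K.
  rewrite (eq_bigr (fun i : 'I_n => (-1) * i.+1%:R)); last first.
    by move=> i _; rewrite hornerXsubC sub0r mulN1r.
  rewrite big_split prodr_const card_ord /= fact_prod natr_prod.
  by rewrite big_add1 /= big_mkord.
rewrite factS natrM invfM; field.
by rewrite fact_neq0 addrC natr1 natrS_neq0.
Qed.

(** Newton's forward difference formula. By induction applied to Delta p, both sides have the same
    difference, so they differ by a constant; this is 0 because they agree at 0. *)
Lemma newton p n : (size p <= n)%N ->
  p = \sum_(j < n) (iter j (@fdiff K) p).[0] *: bpoly j.
Proof.
elim: n p => [|n IHn] p le_pn.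
  by rewrite big_ord0; apply/eqP; rewrite -size_poly_eq0 -leqn0.
set q := \sum_(j < _) _.
have : fdiff (p - q) = 0.
  rewrite linearB /= {1}[fdiff p]IHn ?size_fdiff_leq // /q big_ord_recl.
  rewrite linearP. rewrite linear_sum /= bpoly0.
  rewrite [X in _ *: X](_ : _ = 0) ?scaler0 ?add0r; last first.
    by rewrite /fdiff -polyC1 comp_polyC subrr.
  apply/subr0_eq; rewrite subr0 -sumrB big1 // => j _.
  rewrite [bump 0 j]add1n add0n [fdiff (_ *: _)]linearZ /=.
  by rewrite fdiff_bpolyS -iterS iterSr subrr.
move/fdiff_eq0 => Dpq; apply/subr0_eq; rewrite {}Dpq.
rewrite hornerD hornerN /q horner_sum big_ord_recl hornerZ bpoly0.
rewrite hornerC mulr1 big1 ?addr0 ?subrr // => j _.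
by rewrite hornerZ bpolyS0 mulr0.
Qed.

(** Raising every index in the Newton expansion of [p] inverts Delta; the absence of [bpoly 0] gives
    the value 0 at 0. *)
Lemma fdiff_surj p :
  exists q, [/\ q.[0] = 0, fdiff q = p & (size q <= (size p).+1)%N].
Proof.
exists (\sum_(j < size p) (iter j (@fdiff K) p).[0] *: bpoly j.+1); split.
- by rewrite horner_sum big1 // => j _; rewrite hornerZ bpolyS0 mulr0.
- rewrite linear_sum [RHS](newton (leqnn _)); apply: eq_bigr => j _ /=.
  by rewrite [fdiff _]linearZ /= fdiff_bpolyS.
- apply: leq_trans (size_sum _ _ _) _; apply/bigmax_leqP => j _.
  apply: leq_trans (size_scale_leq _ _) _.
  by apply: leq_trans (size_bpoly _) _; rewrite ltnS.
Qed.

(** * Series in Delta acting on polynomials *)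

(* The pairing <g, p> = (g(Delta) p)(0) of a series with a polynomial. It does *)
(* not depend on the bound n once n >= size p. *)
Definition delta_pairing n (g : fps K) p : K :=
  \sum_(j < n) g j * (iter j (@fdiff K) p).[0].

Lemma delta_pairing_widen n g p : (size p <= n)%N ->
  delta_pairing n g p = delta_pairing (size p) g p.
Proof.
pose F j := g j * (iter j (@fdiff K) p).[0].
move=> le_pn; rewrite [RHS](big_ord_widen _ F le_pn).
rewrite [RHS]big_mkcond; apply: eq_bigr => j _; case: ltnP => // le_pj.
by rewrite iter_fdiff_eq0 // horner0 mulr0.
Qed.

(** Newton's expansion evaluated at [a]: (1 + Delta)^a is translation by [a]. *)
Lemma delta_pairing_pow1pz n a p : (size p <= n)%N ->
  delta_pairing n (pow1pz a) p = p.[a].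
Proof.
move=> le_pn; rewrite [in RHS](newton le_pn) horner_sum.
by apply: eq_bigr => j _; rewrite hornerZ bpolyE mulrC.
Qed.

(** Newton's expansion differentiated at 0: log(1 + Delta) is derivation. *)
Lemma delta_pairing_log1pz n p : (size p <= n)%N ->
  delta_pairing n (log1pz K) p = p^`().[0].
Proof.
move=> le_pn; rewrite [in RHS](newton le_pn) raddf_sum horner_sum.
by apply: eq_bigr => j _; rewrite /= derivZ hornerZ deriv_bpoly0 mulrC.
Qed.

(** Exponents of Delta add, so the product series acts as the composite a(Delta) b(Delta). The
    Cauchy product is reindexed by k = j - i. *)
Lemma delta_pairing_mul n a b p : (size p <= n)%N ->
  delta_pairing n (fps_mul a b) p
  = \sum_(i < n) a i * delta_pairing n b (iter i (@fdiff K) p).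
Proof.
move=> le_pn; rewrite /delta_pairing.
pose F i k := a i * (b k * (iter (k + i) (@fdiff K) p).[0]).
transitivity (\sum_(j < n) \sum_(i < n | (i <= j)%N) F i (j - i)%N).
  apply: eq_bigr => j _; rewrite mulr_suml.
  rewrite (big_ord_widen n
    (fun i => a i * b (j - i)%N * (iter j (@fdiff K) p).[0])) //.
  by apply: eq_bigr => i le_ij; rewrite /F subnK // mulrA.
rewrite (exchange_big_dep xpredT) //=; apply: eq_bigr => i _.
rewrite mulr_sumr.
transitivity (\sum_(k < n - i) F i k).
  rewrite -(big_mkord (fun j => i <= j)%N (fun j => F i (j - i)%N)).
  rewrite (big_cat_nat (n := i)) //=; last exact: ltnW.
  rewrite big_nat_cond big_pred0 ?add0r => [|j]; last first.
    by rewrite andbC leq0n /= andbC ltnNge andNb.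
  rewrite big_nat_cond (eq_bigl (fun j => i <= j < n)%N); last first.
    by move=> j; case: (i <= j)%N; rewrite ?andbT ?andbF.
  rewrite -big_nat -{1}[nat_of_ord i]add0n big_addn big_mkord.
  by apply: eq_bigr => k _; rewrite addnK.
(* Extending the range of k from n - i to n adds only zeros: there Delta^(k + i) kills [p]. *)
rewrite (big_ord_widen n (fun k => F i k)) ?leq_subr // big_mkcond.
apply: eq_bigr => k _; rewrite /F -iterD; case: ltnP => // le_nk.
rewrite iter_fdiff_eq0 ?horner0 ?mulr0 // (leq_trans le_pn) //.
by rewrite addnC -leq_subLR.
Qed.

Lemma delta_pairing_log_exp s n p : (size p <= n)%N ->
  delta_pairing n (fps_exp (log1pz K) s) p = p^`(s).[0].
Proof.
elim: s n p => [|s IHs] n p le_pn.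
  (* The bound becomes [(size p).+1], a successor even if n = 0, so that the only nonzero term j = 0
     can be split off. *)
  rewrite (delta_pairing_widen _ le_pn) -(delta_pairing_widen _ (leqnSn _)).
  rewrite /delta_pairing big_ord_recl mul1r big1 ?addr0 // => j _.
  by rewrite mul0r.
rewrite delta_pairing_mul //.
rewrite (eq_bigr (fun i : 'I_n => log1pz K i * (iter i (@fdiff K) p^`(s)).[0])).
  rewrite -/(delta_pairing _ _ _).
  by rewrite delta_pairing_log1pz ?derivnS ?size_derivn_leq.
by move=> i _; rewrite IHs ?derivn_iter_fdiff // size_iter_fdiff_leq.
Qed.

Lemma delta_pairing_pow_log a s n p : (size p <= n)%N ->
  delta_pairing n (fps_mul (pow1pz a) (fps_exp (log1pz K) s)) p = p^`(s).[a].
Proof.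
move=> le_pn; rewrite delta_pairing_mul //.
rewrite (eq_bigr (fun i : 'I_n => pow1pz a i * (iter i (@fdiff K) p^`(s)).[0])).
  by rewrite -/(delta_pairing _ _ _) delta_pairing_pow1pz // size_derivn_leq.
move=> i _.
by rewrite delta_pairing_log_exp ?derivn_iter_fdiff // size_iter_fdiff_leq.
Qed.

(** * The functionals phi on inverse Mellin transforms *)

(* (e^z - 1)^j is dual to Delta^j: both are built from e^z - 1 by iteration,  *)
(* as Delta = e^D - 1. *)
Lemma expz_sub1_exp j k :
  k`!%:R * fps_exp (fps_sub (expz K) (fps_one K)) j k
  = (iter j (@fdiff K) 'X^k).[0].
Proof.
elim: j k => [|j IHj] k.
  rewrite hornerXn /fps_exp /= /fps_one.
  by case: k => [|k]; rewrite ?expr0n ?mulr0 ?mulr1.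
rewrite iter_fdiff_Xn0 [fps_exp _ _]/= /fps_mul mulr_sumr [RHS]big_mkcond.
apply: eq_bigr => i _; have le_ik : (i <= k)%N by rewrite -ltnS.
rewrite /fps_sub /fps_one; case: eqP => [->|_] /=.
  by rewrite /expz invr1 subrr mul0r mulr0.
rewrite subr0 -IHj mulrA mulrCA mulrA; congr (_ * _).
rewrite -(bin_fact le_ik) !natrM /expz; field.
by rewrite fact_neq0.
Qed.

(** On X^k, the reflection contributes (-1)^k and the transform (-1)^(k + 1), leaving -1; the
    duality of (e^z - 1)^j with Delta^j does the rest. *)
Lemma phi_inv_mellin g p n : (size p <= n)%N ->
  phi (inv_mellin g) (p \Po (- 'X)) = - delta_pairing n g p.
Proof.
move=> le_pn; rewrite /delta_pairing comp_polyE raddf_sum /=.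
rewrite -[in RHS](coefK p) poly_def.
under [in RHS]eq_bigr do rewrite linear_sum horner_sum mulr_sumr.
rewrite exchange_big /= -sumrN; apply: eq_bigr => k _.
have le_kn : (k < n)%N by apply: leq_trans le_pn.
under [in RHS]eq_bigr do rewrite linearZ hornerZ mulrCA /=.
rewrite -mulr_sumr -mulrN linearZ /=; congr (_ * _).
rewrite exprNn -polyC1 -polyCN -polyC_exp mul_polyC linearZ /= phiXn.
rewrite /inv_mellin exprSr mulrN1 mulrN mulrN mulrCA -exprMn mulrNN mulr1.
rewrite expr1n mulr1; congr (- _).
rewrite /inv_mellin_coef /fps_comp mulr_sumr.
(* The composite stops at j = k; the terms added up to n match Delta^j X^k = 0 for j > k. *)
rewrite (big_ord_widen n (fun j => k`!%:R
  * (g j * fps_exp (fps_sub (expz K) (fps_one K)) j k))) //.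
rewrite big_mkcond; apply: eq_bigr => j _; case: ltnP => [_|lt_kj].
  by rewrite mulrCA expz_sub1_exp.
by rewrite iter_fdiff_eq0 ?horner0 ?mulr0 // size_polyXn.
Qed.

(** Division by z lowers each index by one, which the extra Delta on [p] compensates; only the term
    j = 0 of the pairing is lost. *)
Lemma phi_inv_mellin_divz h p :
  phi (inv_mellin (fps_divz h)) (fdiff p \Po (- 'X))
  = h 0 * p.[0] - delta_pairing (size p).+1 h p.
Proof.
rewrite (@phi_inv_mellin _ _ (size p)) ?size_fdiff_leq //.
rewrite /delta_pairing big_ord_recl opprD addNKr.
by congr (- _); apply: eq_bigr => j _; rewrite -iterSr.
Qed.

Lemma phi_Rser a s p : (0 < s)%N ->
  p.[0] = 0 -> phi (Rser a s) (fdiff p \Po (- 'X)) = - p^`(s.-1).[a].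
Proof.
case: s => // -[|s] _ p0; rewrite /Rser /= phi_inv_mellin_divz p0 mulr0 sub0r.
  (* Case s = 1: subtracting 1 from (1 + z)^a affects only the term j = 0, which carries the factor
     p(0) = 0. *)
  rewrite -[in RHS](delta_pairing_pow1pz a (leqnSn (size p))).
  rewrite /delta_pairing !big_ord_recl /= p0 !mulr0 !add0r.
  by congr (- _); apply: eq_bigr => j _; rewrite /fps_sub subr0.
by rewrite -[RHS](congr1 -%R (delta_pairing_pow_log a s.+1 (leqnSn _))).
Qed.

End Newton.

(** * Multiplicities of zeros under translation and reflection *)

Section Multiplicity.
Variable K : fieldType.
Hypothesis K0 : [pchar K] =i pred0.
Implicit Types (p q : {poly K}) (a c : K).

Lemma comp_poly_shiftK c p : (p \Po ('X + c%:P)) \Po ('X - c%:P) = p.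
Proof.
by rewrite -comp_polyA comp_polyD comp_polyX comp_polyC subrK comp_polyXr.
Qed.

Lemma comp_poly_oppK p : (p \Po (- 'X)) \Po (- 'X) = p.
Proof.
by rewrite -comp_polyA linearN /= comp_polyX opprK comp_polyXr.
Qed.

(** After translating [a] to 0, s! times the coefficient of X^s is the s-th derivative at [a], and
    s! is invertible. *)
Lemma dvdp_XsubC_exp_derivn a n p :
  (forall s, (s < n)%N -> p^`(s).[a] = 0) -> ('X - a%:P) ^+ n %| p.
Proof.
move=> pa0; pose q := p \Po ('X + a%:P).
have Dq s : q^`(s) = p^`(s) \Po ('X + a%:P).
  elim: s => // s IHs; rewrite !derivnS IHs deriv_comp derivD derivX derivC.
  by rewrite addr0 mulr1.
have take_q : take_poly n q = 0.
  apply/polyP => s; rewrite coef_take_poly coef0; case: ltnP => // lt_sn.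
  have := coef_derivn s q 0; rewrite addn0 ffactnn -horner_coef0 Dq horner_comp.
  rewrite hornerD hornerX hornerC add0r pa0 // -mulr_natr => /esym/eqP.
  by rewrite mulf_eq0 (negPf (fact_neq0 K0 s)) orbF => /eqP.
rewrite -[p](comp_poly_shiftK a) -/q -[q](poly_take_drop n) take_q add0r.
by rewrite comp_polyM comp_Xn_poly dvdp_mull.
Qed.

(** p(X + 1) = p + Delta p is divisible by (X - a)^n; translate back. *)
Lemma dvdp_XsubC_exp_shift a n p :
  ('X - a%:P) ^+ n %| p -> ('X - a%:P) ^+ n %| fdiff p ->
  ('X - (a + 1)%:P) ^+ n %| p.
Proof.
move=> dvd_p dvd_dp.
have: ('X - a%:P) ^+ n %| p \Po ('X + 1%:P).
  by rewrite -[_ \Po _](subrK p) dvdp_add.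
move/(dvdp_comp_poly ('X - 1%:P)); rewrite comp_poly_shiftK.
rewrite rmorphXn /= comp_polyB comp_polyX comp_polyC.
by rewrite -addrA -opprD -polyCD [1 + a]addrC.
Qed.

Lemma dvdp_XaddC_exp_reflect c n p :
  ('X - c%:P) ^+ n %| p -> ('X + c%:P) ^+ n %| p \Po (- 'X).
Proof.
move/(dvdp_comp_poly (- 'X)); apply: dvdp_trans.
rewrite rmorphXn /= comp_polyB comp_polyX comp_polyC -opprD exprNn.
by rewrite dvdp_mull.
Qed.

Lemma dvdp_prod_XaddC_exp (I : finType) (c : I -> K) (e : I -> nat) p :
  injective c -> (forall i, ('X + (c i)%:P) ^+ e i %| p) ->
  \prod_i ('X + (c i)%:P) ^+ e i %| p.
Proof.
move=> inj_c dvd_p; have := index_enum_uniq I.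
elim: (index_enum I) => [|i s IHs] /=; first by rewrite big_nil dvd1p.
move=> /andP[s'i /IHs dvd_s]; rewrite big_cons Gauss_dvdp ?dvd_p //.
rewrite coprimep_expl // coprimep_sym -[c i]opprK polyCN coprimep_XsubC rootE.
rewrite horner_prod prodf_seq_neq0; apply/allP => j s_j /=.
rewrite horner_exp expf_neq0 // hornerD hornerX hornerC addrC subr_eq0.
by rewrite (inj_eq inj_c); apply: contraNneq s'i => <-.
Qed.

End Multiplicity.

(** * Zeros forced on the antidifference *)

Section Nonsingular.
Variable K : fieldType.
Hypothesis K0 : [pchar K] =i pred0.
Variables (d : nat) (m N : 'I_d -> nat).
Variables (r : forall j : 'I_d, 'I_(N j).+1 -> nat) (alpha : 'I_d -> K).

(** Used with c = 0 to factor A itself and with c = 1 for the translate whose roots are the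
    reflected zeros of [p] beyond the alpha_j. *)
Lemma Apoly_shift c :
  Apoly r alpha \Po ('X + c%:P)
  = \prod_(j < d) \prod_(i < (N j).+1)
      ('X + (alpha j + (c + i%:R))%:P) ^+ r i.
Proof.
rewrite rmorph_prod; apply: eq_bigr => j _ /=.
rewrite /Bpoly -comp_polyA rmorph_prod; apply: eq_bigr => i _ /=.
rewrite rmorphXn /= !(comp_polyD, comp_polyX, comp_polyC) -!addrA -!polyCD.
by rewrite addrCA.
Qed.

Hypothesis hr0 : forall j : 'I_d, (r (ord0 : 'I_(N j).+1) <= (m j).+1)%N.
Hypothesis hr : forall (j : 'I_d) (i i' : 'I_(N j).+1),
  (i <= i')%N -> (r i' <= r i)%N.
Variables (p q : {poly K}).
Hypothesis p_alpha :
  forall j s, (s < (m j).+1)%N -> p^`(s).[alpha j] = 0.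
Hypothesis fdiff_p : fdiff p = (q * Apoly r alpha) \Po (- 'X).

Lemma dvdp_Apoly_root j (i : 'I_(N j).+1) :
  ('X - (alpha j + i%:R)%:P) ^+ r i %| fdiff p.
Proof.
rewrite fdiff_p rmorphM /= dvdp_mull //.
have := Apoly_shift 0; rewrite addr0 comp_polyXr => ->.
rewrite (bigD1 j) // (bigD1 i) //= !rmorphM /= !dvdp_mulr // add0r.
rewrite rmorphXn /= comp_polyD comp_polyX comp_polyC.
set x := _%:P; have -> : - 'X + x = - ('X - x) by rewrite opprB addrC.
by rewrite exprNn dvdp_mull.
Qed.

(* The zero of order m_j + 1 at alpha_j propagates along alpha_j + N, losing   *)
(* at each step no more than what fdiff p allows. *)
Lemma dvdp_chain_root j (i : 'I_(N j).+1) :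
  ('X - (alpha j + i.+1%:R)%:P) ^+ r i %| p.
Proof.
have shift (k : 'I_(N j).+1) :
  ('X - (alpha j + k%:R)%:P) ^+ r k %| p ->
  ('X - (alpha j + k.+1%:R)%:P) ^+ r k %| p.
  move=> dvd_p; rewrite -natr1 addrA.
  by apply: dvdp_XsubC_exp_shift => //; apply: dvdp_Apoly_root.
apply: (shift); case: i => i; elim: i => [|i IHi] lt_iN.
  rewrite addr0; apply: dvdp_XsubC_exp_derivn => // s lt_s.
  apply: p_alpha; apply: leq_trans lt_s _.
  by rewrite (_ : Ordinal _ = ord0) //; apply: val_inj.
apply: dvdp_trans (shift _ (IHi (ltnW lt_iN))).
by apply: dvdp_exp2l; apply: hr.
Qed.

Hypothesis halpha : forall i j : 'I_d, i != j ->
  forall n : int, alpha i - alpha j <> n%:~R.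

(** The zeros found at alpha_j and at alpha_j + i + 1 lie at distinct points, so their
    multiplicities combine into one divisor, written after reflection. *)
Lemma dvdp_chain_prod :
  (\prod_(j < d) ('X + (alpha j)%:P) ^+ (m j).+1)
    * (Apoly r alpha \Po ('X + 1%:P)) %| p \Po (- 'X).
Proof.
(* Points are indexed by pairs (j, k) with k <= N_j + 1: k = 0 carries the order m_j + 1, and k = i
   + 1 the order r_i. *)
pose c (t : {j : 'I_d & 'I_(N j).+2}) := alpha (tag t) + (tagged t)%:R.
pose e j (k : 'I_(N j).+2) := if unlift ord0 k is Some i then r i else (m j).+1.
have -> : (\prod_(j < d) ('X + (alpha j)%:P) ^+ (m j).+1)
    * (Apoly r alpha \Po ('X + 1%:P))
  = \prod_t ('X + (c t)%:P) ^+ e (tag t) (tagged t).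
  rewrite Apoly_shift -big_split /=.
  transitivity (\prod_(j < d) \prod_(k < (N j).+2)
      ('X + (alpha j + k%:R)%:P) ^+ e j k); last by rewrite sig_big_dep.
  apply: eq_bigr => j _; rewrite big_ord_recl /e unlift_none addr0.
  congr (_ * _); apply: eq_bigr => i _; rewrite liftK /bump /=.
  by rewrite natrD.
apply: dvdp_prod_XaddC_exp => [[j k] [j' k']|[j k]].
  (* Equal points force equal j, as distinct alphas do not differ by an integer, and then equal k by
     characteristic 0. *)
  rewrite /c /= => eq_c; have [eq_j | neq_j] := eqVneq j j'.
    case: j' / eq_j k' eq_c => k' /addrI/eqP.
    by rewrite eqr_nat_pchar0 // => /eqP/val_inj->.
  case: (halpha neq_j (n := k'%:Z - k%:Z)); rewrite intrB -!pmulrn.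
  by apply/eqP; rewrite subr_eq addrAC -subr_eq opprK eq_c addrC.
apply: dvdp_XaddC_exp_reflect; rewrite /c /e /=.
case: unliftP => [i ->|->]; first exact: dvdp_chain_root.
rewrite addr0; apply: dvdp_XsubC_exp_derivn => // s; exact: p_alpha.
Qed.

End Nonsingular.

(** * From a kernel vector to the degree count *)

Theorem theorem8p3 (K : fieldType) (K0 : [pchar K] =i pred0)
  (d : nat) (hd : (0 < d)%N)
  (m : 'I_d -> nat) (hm1 : (1 <= m (idx1 hd))%N)
  (N : 'I_d -> nat) (r : forall j : 'I_d, 'I_(N j).+1 -> nat)
  (hr0 : forall j : 'I_d, (r j ord0 <= (m j).+1)%N)
  (hr : forall (j : 'I_d) (i i' : 'I_(N j).+1),
     (i <= i')%N -> (r j i' <= r j i)%N)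
  (alpha : 'I_d -> K) (halpha1 : alpha (idx1 hd) = 0)
  (halpha : forall i j : 'I_d, i != j ->
     forall n : int, alpha i - alpha j <> n%:~R) :
  phi_matrix hd m r alpha \in unitmx.
Proof.
(* Columns correspond to powers of t, so a left kernel vector of the transpose lists the
   coefficients of [q]. *)
rewrite unitmxE unitfE -det_tr; apply: contraT; rewrite negbK.
case/det0P => v nz_v vA0; pose q := rVpoly v.
have nz_q : q != 0 by rewrite -(inj_eq (can_inj rVpolyK)) linear0 in nz_v.
set A := Apoly r alpha in vA0 *.
have phi_qA i s : (0 < s <= (m i).+1)%N -> (i, s) != (idx1 hd, 1%N) ->
    phi (Rser (alpha i) s) (q * A) = 0.
  move=> s_int neq_is; have: (i, s) \in cI hd m by rewrite mem_cI_seq s_int.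
  case/tnthP => k Dk; move/matrixP/(_ 0 k): vA0; rewrite !mxE => <-.
  rewrite /q /rVpoly poly_def mulr_suml linear_sum; apply: eq_bigr => l _.
  rewrite !mxE -Dk insubT //= => lt_l; rewrite -scalerAl linearZ /=.
  by congr (v _ _ * _); apply: val_inj.
have [p [p0 fdiff_p le_p]] := fdiff_surj K0 ((q * A) \Po (- 'X)).
have sizeN (u : {poly K}) : size (u \Po (- 'X)) = size u.
  by rewrite size_comp_poly2 // size_polyN size_polyX.
have p_alpha j s : (s < (m j).+1)%N -> p^`(s).[alpha j] = 0.
  (* The pair (1, 1), which has no row, is covered by the normalisation p(0) = 0, since alpha_1 =
     0. *)
  move=> lt_s; have [[-> ->]|neq_js] := eqVneq (j, s.+1) (idx1 hd, 1%N).
    by rewrite halpha1.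
  apply: oppr_inj; rewrite oppr0 -(phi_Rser K0 (alpha j) (s := s.+1)) //.
  by rewrite fdiff_p comp_poly_oppK phi_qA.
pose E := \prod_(j < d) ('X + (alpha j)%:P) ^+ (m j).+1.
pose A1 := A \Po ('X + 1%:P).
have dvd_p : E * A1 %| p \Po (- 'X).
  exact: (dvdp_chain_prod K0 hr0 hr p_alpha fdiff_p halpha).
have monE : E \is monic.
  by apply: monic_prod => j _; rewrite monic_exp // monicXaddC.
have sizeE : size E = (\sum_(j < d) (m j).+1).+1.
  rewrite size_prod => [|j _]; last first.
    by rewrite monic_neq0 // monic_exp // monicXaddC.
  rewrite (eq_bigr (fun j => (m j).+1 + 1)%N) => [|j _]; last first.
    by rewrite -[alpha j]opprK polyCN size_exp_XsubC addn1.
  by rewrite big_split /= sum1_card -addSn addnK.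
have sizeA1 : size A1 = size A by rewrite size_comp_poly2 // size_XaddC.
have nzA1 : A1 != 0.
  rewrite /A1 Apoly_shift monic_neq0 //.
  apply: monic_prod => j _; apply: monic_prod => i _.
  by rewrite monic_exp // monicXaddC.
have nzA : A != 0 by rewrite -size_poly_eq0 -sizeA1 size_poly_eq0.
have nz_p : p \Po (- 'X) != 0.
  rewrite -size_poly_eq0 sizeN size_poly_eq0; apply: contraTneq nz_q => p_eq0.
  have : q * A = 0.
    by rewrite -[LHS]comp_poly_oppK -fdiff_p p_eq0 linear0 comp_poly0.
  by move/eqP; rewrite mulf_eq0 (negPf nzA) orbF => ->.
(* The divisor has degree M + 1 + deg A, whereas deg p <= 1 + deg q + deg A <= M + deg A. *)
have := dvdp_leq nz_p dvd_p; rewrite sizeN => /leq_trans/(_ le_p).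
rewrite sizeN (size_mul (monic_neq0 monE) nzA1) (size_mul nz_q nzA).
rewrite sizeA1 sizeE.
have : (size q <= cI_size m)%N by apply: size_poly.
have : (0 < size q)%N by rewrite size_poly_gt0.
have : (0 < size A)%N by rewrite size_poly_gt0.
have -> : \sum_(j < d) (m j).+1 = (\sum_(j < d) m j + d)%N.
  under eq_bigr do rewrite -addn1.
  by rewrite big_split /= sum1_card card_ord.
rewrite /cI_size; move: (\sum_(i < d) m i)%N (size A) (size q) => S a b.
move=> *; exfalso; lia.
Qed.
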